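(* Let $\alpha\in(0,1)$, $f:\mathbb R\to\mathbb R$, $u_0\in\mathbb R$, and consider the scalar autonomous fractional ODE $\mathcal D_c^\alpha u=f(u)$, $u(0)=u_0$. Suppose a $\mathcal{CM}$-preserving scheme with step size $h>0$ is applied, i.e. $\{u_n\}$ satisfies $u_n=u_0+h^\alpha\sum_{j=0}^{n-1}a_jf(u_{n-j})$ for $n\ge1$. (i) If $f$ is $C^1$ and non-increasing, then for any step size $h>0$ the numerical solution $\{u_n\}_{n\ge0}$ is monotone. (ii) If $f$ is $C^1$ with $M:=\sup_{u}|f'(u)|<\infty$, then whenever $h^\alpha Ma_0<1$, the numerical solution $\{u_n\}_{n\ge0}$ is monotone.
   Context: A real sequence $v=(v_0,v_1,\dots)$ is completely monotone if $((I-E)^jv)_k\ge 0$ for all $j,k\ge 0$, where $(Ev)_k=v_{k+1}$. Convolution: $(u*v)_n=\sum_{j=0}^n u_jv_{n-j}$, with identity $\delta_d=(1,0,0,\dots)$; $\omega^{(-1)}$ is the sequence with $\omega*\omega^{(-1)}=\delta_d$. For $\alpha\in(0,1)$ and step size $h>0$, a real sequence $\omega$ with $\omega_0\ne0$ (independent of $h$) defines the scheme $h^{-\alpha}\sum_{j=0}^n\omega_j(u_{n-j}-u_0)=f(t_n,u_n)$, $n\ge1$, $t_n=nh$, for the Caputo fractional ODE $\mathcal D_c^\alpha u=f(t,u)$, $u(0)=u_0$; equivalently, with $a=\omega^{(-1)}$, $u_n=u_0+h^\alpha\sum_{j=0}^{n-1}a_jf(t_{n-j},u_{n-j})$, $n\ge1$.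 With $F_a(z)=\sum_{n\ge0}a_nz^n$, the scheme is consistent if $h^\alpha F_a(e^{-h})=1+o(1)$ as $h\to0^+$. A scheme is $\mathcal{CM}$-preserving if it is consistent and $a=\omega^{(-1)}$ is completely monotone. A real sequence is monotone if it is non-decreasing or non-increasing. *)

(* Defs.v *)
From HB Require Import structures.
From mathcomp Require Import all_boot all_order all_algebra.
From mathcomp Require Import all_classical all_reals all_analysis.
Set Implicit Arguments.
Unset Strict Implicit.
Unset Printing Implicit Defensive.
Import Order.TTheory GRing.Theory Num.Theory.
Import numFieldNormedType.Exports.
Local Open Scope classical_set_scope.
Local Open Scope ring_scope.

Definition seq_shift (R : realType) (v : nat -> R) : nat -> R := fun k => v k.+1.

Definition diff_shift (R : realType) (v : nat -> R) : nat -> R :=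
  fun k => v k - seq_shift v k.

Definition completely_monotone (R : realType) (v : nat -> R) : Prop :=
  forall j k : nat, 0 <= iter j (@diff_shift R) v k.

Definition convolution (R : realType) (u v : nat -> R) : nat -> R :=
  fun n => \sum_(0 <= j < n.+1) u j * v (n - j)%N.

Definition delta_d (R : realType) : nat -> R := fun n => (n == 0%N)%:R.

(* When [omega 0 != 0] such an [a] exists and is unique, so this relation is
   the graph of the partial function [omega |-> omega^(-1)]. *)
Definition is_conv_inverse (R : realType) (omega a : nat -> R) : Prop :=
  forall n : nat, convolution omega a n = delta_d R n.

Definition gen_fun (R : realType) (a : nat -> R) (z : R) : R :=
  limn (pseries a z).

(* [limn] is a total function, so convergence of the power series at
   [exp (- h)] for small positive [h] is required explicitly. *)
Definition consistent (R : realType) (alpha : R) (a : nat -> R) : Prop :=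
  (\forall h \near 0^'+, cvgn (pseries a (expR (- h)))) /\
  h `^ alpha * gen_fun a (expR (- h)) @[h --> 0^'+] --> (1 : R).

Definition CM_preserving (R : realType) (alpha : R) (omega a : nat -> R)
    : Prop :=
  [/\ omega 0%N != 0, is_conv_inverse omega a, consistent alpha a
    & completely_monotone a].

(* The scheme is implicit: [u n] also occurs on the right-hand side (j = 0). *)
Definition numerical_solution (R : realType) (alpha h : R) (a : nat -> R)
    (f : R -> R) (u0 : R) (u : nat -> R) : Prop :=
  u 0%N = u0 /\
  forall n : nat, (1 <= n)%N ->
    u n = u0 + h `^ alpha * \sum_(0 <= j < n) a j * f (u (n - j)%N).

Definition C1 (R : realType) (f : R -> R) : Prop :=
  (forall x : R, derivable f x 1) /\ continuous (f^`()%classic : R -> R).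

Definition monotone_seq (R : realType) (u : nat -> R) : Prop :=
  nondecreasing_seq u \/ nonincreasing_seq u.

(* Main.v *)
Require Import Defs.
From HB Require Import structures.
From mathcomp Require Import all_boot all_order all_algebra.
From mathcomp Require Import all_classical all_reals all_analysis.
From mathcomp Require Import ring lra.
Set Implicit Arguments.
Unset Strict Implicit.
Unset Printing Implicit Defensive.
Import Order.TTheory GRing.Theory Num.Theory.
Import numFieldNormedType.Exports.
Local Open Scope classical_set_scope.
Local Open Scope ring_scope.

(** Write [w n = u n - u 0] and [v n = u n.+1 - u n]. Convolving the scheme
with [omega] undoes the convolution with [a]: [omega * w] is
[h `^ alpha * f (u n)] at every [n >= 1]. Differencing in [n] gives, for
[n >= 1], [(omega * v) n = h `^ alpha * (f (u n.+1) - f (u n))]. Since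
[f (u n.+1) - f (u n) = d * v n] for a slope [d] of a chord of [f], this reads

  [(omega 0 - h `^ alpha * d) * v n = \sum_(1 <= j < n.+1) - omega j * v (n - j)].

If the bracket is positive and [omega j <= 0] for [j >= 1], every [v n] inherits
by induction the sign of [v 0], which is monotonicity of [u]
([conv_sign_propagation]). The bracket is positive as soon as
[h `^ alpha * d < (a 0)^-1 = omega 0]; chords of a non-increasing [f] have
[d <= 0], and in general [d <= sup |f'|] by the mean value theorem. The two cases
are thus instances of one statement about a bound on the chord slopes
([monotone_of_chord_slopes]).

The sign of [omega] comes from two facts. A completely monotone sequence is
log-convex ([completely_monotone_log_convex]), and the convolution inverse of a
log-convex sequence has non-positive entries away from the index 0, by a theorem
of Kaluza ([conv_inverse_le0]). For moments of a measure on [[0, 1]]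
log-convexity is the Cauchy-Schwarz inequality; here it is obtained directly
from the difference inequalities, by a finite form of Hausdorff's moment theorem
([binomial_square_ge0]). *)

(** * Convolution *)

Section Convolution.
Variable R : realType.
Implicit Types u v w : nat -> R.

(** Up to any finite index, convolution is the product of truncated generating
polynomials; this transports the ring laws. *)
Lemma convolution_coefM (N n : nat) u v : (n < N)%N ->
  convolution u v n = ((\poly_(i < N) u i) * (\poly_(i < N) v i))`_n.
Proof.
move=> ltnN; rewrite /convolution coefM big_mkord; apply: eq_bigr => i _.
rewrite !coef_poly (leq_ltn_trans (leq_subr _ _) ltnN).
by rewrite (leq_ltn_trans _ ltnN) // -ltnS.
Qed.

Lemma convolutionA u v w :
  convolution u (convolution v w) = convolution (convolution u v) w.
Proof.
apply/funext => n.
set P := fun x : nat -> R => \poly_(i < n.+1) x i.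
transitivity ((P u * (P v * P w))`_n).
  rewrite coefM /convolution big_mkord; apply: eq_bigr => i _.
  rewrite coef_poly ltn_ord; congr (_ * _).
  by apply: convolution_coefM; rewrite ltnS leq_subr.
rewrite mulrA coefM /convolution big_mkord; apply: eq_bigr => i _.
rewrite coef_poly ltnS leq_subr; congr (_ * _).
by apply/esym/convolution_coefM.
Qed.

Lemma convolution_delta_l u : convolution (delta_d R) u = u.
Proof.
apply/funext => n; rewrite /convolution big_nat_recl // /delta_d eqxx mul1r.
by rewrite subn0 big1 ?addr0 // => i _; rewrite mul0r.
Qed.

Lemma convolution_shift_sub u v n : v 0%N = 0 ->
  convolution u v n.+1 - convolution u v n
  = convolution u (fun k => v k.+1 - v k) n.
Proof.
move=> v0; rewrite /convolution big_nat_recr //= subnn v0 mulr0 addr0.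
rewrite -sumrB; apply: eq_big_nat => j /andP[_ ltjn].
by rewrite subSn // mulrBr.
Qed.

Lemma convolution_recl u v n :
  convolution u v n
  = u 0%N * v n + \sum_(1 <= j < n.+1) u j * v (n - j)%N.
Proof. by rewrite /convolution big_ltn // subn0. Qed.

End Convolution.

(** * Completely monotone sequences are log-convex *)

Section LogConvexity.
Variable R : realType.
Implicit Types a : nat -> R.

Lemma completely_monotone_shift a :
  completely_monotone a -> completely_monotone (seq_shift a).
Proof.
move=> cma j k; have -> : iter j (@diff_shift R) (seq_shift a) k
    = iter j (@diff_shift R) a k.+1; last exact: cma.
by elim: j k => [|j IHj] k //=; rewrite /diff_shift /seq_shift !IHj.
Qed.

Lemma completely_monotone_diff a :
  completely_monotone a -> completely_monotone (diff_shift a).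
Proof. by move=> cma j k; rewrite -iterSr. Qed.

Lemma completely_monotone_ge0 a n : completely_monotone a -> 0 <= a n.
Proof. by move=> cma; exact: (cma 0%N n). Qed.

(** If [a k] is the [k]-th moment of a measure [mu] on [[0, 1]], the left-hand
side is the [mu]-integral over [x] of the expectation of [(t - B) ^+ 2], where
[B] is a binomial variable with parameters [N] and [x]. Conditioning on the
first trial splits [a] into [diff_shift a], of density [1 - x] (failure), and
[seq_shift a], of density [x] (success, moving [t] to [t - 1]). Both are
completely monotone, so the induction needs no measure. *)
Lemma binomial_square_ge0 (N : nat) a (t : R) : completely_monotone a ->
  0 <= t ^+ 2 * a 0%N - 2 * t * N%:R * a 1%N
       + N%:R * (N%:R - 1) * a 2%N + N%:R * a 1%N.
Proof.
elim: N a t => [|N IHN] a t cma.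
  have := mulr_ge0 (sqr_ge0 t) (completely_monotone_ge0 0 cma).
  by rewrite !(mul0r, mulr0) subr0 !addr0.
have fail := IHN _ t (completely_monotone_diff cma).
have succ := IHN _ (t - 1) (completely_monotone_shift cma).
apply: le_trans (addr_ge0 fail succ) _; rewrite le_eqVlt; apply/orP; left.
apply/eqP; rewrite /diff_shift /seq_shift -natr1; ring.
Qed.

(** Taking [t = N * s] above and dividing by [N ^+ 2], the variance of the
binomial law only contributes a term of order [1 / N]. *)
Lemma completely_monotone_quadratic a (s : R) : completely_monotone a ->
  0 <= s ^+ 2 * a 0%N - 2 * s * a 1%N + a 2%N.
Proof.
move=> cma; rewrite leNgt; apply/negP => qlt0.
set q := (X in X < 0) in qlt0.
set N := (Num.truncn (`|a 1%N - a 2%N| / - q)).+1.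
have N0 : 0 < N%:R :> R by rewrite ltr0n.
have ltN : `|a 1%N - a 2%N| < N%:R * - q.
  by rewrite -ltr_pdivrMr ?oppr_gt0 // truncnS_gt.
have := binomial_square_ge0 N (N%:R * s) cma.
have -> : (N%:R * s) ^+ 2 * a 0%N - 2 * (N%:R * s) * N%:R * a 1%N
    + N%:R * (N%:R - 1) * a 2%N + N%:R * a 1%N
    = N%:R * (N%:R * q + (a 1%N - a 2%N)) by rewrite /q; ring.
rewrite pmulr_rge0 // => qge.
have := ler_norm (a 1%N - a 2%N); lra.
Qed.

Lemma completely_monotone_log_convex a n : completely_monotone a ->
  a n.+1 ^+ 2 <= a n * a n.+2.
Proof.
move=> cma; elim: n a cma => [|n IHn] a cma; last first.
  exact: (IHn _ (completely_monotone_shift cma)).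
have a0ge := completely_monotone_ge0 0 cma.
have a1ge := completely_monotone_ge0 1 cma.
have [a00|a0neq] := eqVneq (a 0%N) 0.
  have /= := cma 1%N 0%N; rewrite /diff_shift /seq_shift a00 => a1le.
  have -> : a 1%N = 0 by lra.
  by rewrite mul0r expr0n.
have a0gt : 0 < a 0%N by rewrite lt_def a0neq.
(* The minimiser of the quadratic form turns it into its discriminant. *)
have := completely_monotone_quadratic (a 1%N / a 0%N) cma.
have -> : (a 1%N / a 0%N) ^+ 2 * a 0%N - 2 * (a 1%N / a 0%N) * a 1%N + a 2%N
    = (a 0%N * a 2%N - a 1%N ^+ 2) / a 0%N by field.
by rewrite pmulr_lge0 ?invr_gt0 // subr_ge0.
Qed.

End LogConvexity.

(** * Kaluza's sign theorem *)

Section Kaluza.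
Variables (R : realType) (a omega : nat -> R).
Hypothesis a_ge0 : forall n, 0 <= a n.
Hypothesis a_log_convex : forall n, a n.+1 ^+ 2 <= a n * a n.+2.

(** A zero of a log-convex sequence spreads to both neighbours, except that it
cannot reach the index 0 from the index 1. *)
Lemma log_convex_eq0_succ n : (a n.+1 == 0) = (a 1%N == 0).
Proof.
elim: n => [//|n <-].
apply/idP/idP => /eqP an0; rewrite -sqrf_eq0 eq_le sqr_ge0 andbT.
  by rewrite (le_trans (a_log_convex _)) // an0 mulr0.
by rewrite (le_trans (a_log_convex _)) // an0 mul0r.
Qed.

(** The ratios [a i.+1 / a i] increase with [i]. *)
Lemma log_convex_ratio i n : (forall k, 0 < a k) -> (i <= n)%N ->
  a i.+1 * a n <= a i * a n.+1.
Proof.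
move=> a_gt0; elim: n => [|n IHn] lein.
  by move: lein; rewrite leqn0 => /eqP ->; rewrite mulrC.
have [->|neq] := eqVneq i n.+1; first by rewrite mulrC.
have {}lein : (i <= n)%N by rewrite -ltnS ltn_neqAle neq.
rewrite -(ler_pM2r (a_gt0 n)).
apply: (@le_trans _ _ (a i * a n.+1 * a n.+1)).
  by rewrite mulrAC ler_pM2r // IHn.
by rewrite -!mulrA ler_pM2l // -expr2 [leRHS]mulrC.
Qed.

Hypothesis omega_inv : is_conv_inverse omega a.

Lemma conv_inverse0 : omega 0%N * a 0%N = 1.
Proof. by have := omega_inv 0%N; rewrite /convolution big_nat1 subnn. Qed.

Lemma conv_inverse0_gt0 : 0 < omega 0%N.
Proof.
have a0neq : a 0%N != 0.
  by apply/eqP => a00; have := conv_inverse0; rewrite a00 mulr0; lra.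
by rewrite -(pmulr_lgt0 _ (x := a 0%N)) ?conv_inverse0 // lt_def a0neq a_ge0.
Qed.

(** When [a] is positive, eliminate [omega 0] between the equations at [n] and
[n.+1] of [omega * a = delta_d]: this expresses [omega n.+1 * a 0 * a n] as a
combination of the previous [omega j] with coefficients that have a sign by
log-convexity. Otherwise [a] is a multiple of [delta_d], and so is [omega]. *)
Lemma conv_inverse_le0 n : omega n.+1 <= 0.
Proof.
have o0 := conv_inverse0_gt0.
have a0 : 0 < a 0%N by rewrite -(pmulr_rgt0 _ o0) conv_inverse0.
have eqS m : omega 0%N * a m.+1 + \sum_(1 <= j < m.+1) omega j * a (m.+1 - j)%N
    + omega m.+1 * a 0%N = 0.
  have := omega_inv m.+1.
  by rewrite convolution_recl big_nat_recr //= subnn addrA.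
have [a1|a1] := eqVneq (a 1%N) 0.
  have aS k : a k.+1 = 0 by apply/eqP; rewrite log_convex_eq0_succ a1.
  move: (eqS n); rewrite aS mulr0 add0r big_nat_cond big1 => [|j].
    by rewrite add0r => /eqP; rewrite mulf_eq0 (gt_eqF a0) orbF => /eqP ->.
  by rewrite andbT => /andP[_ ltjn]; rewrite subSn // aS mulr0.
have a_gt0 k : 0 < a k.
  by case: k => // k; rewrite lt_def a_ge0 log_convex_eq0_succ a1.
elim/ltn_ind: n => n IHn; case: n IHn => [|n] IHn.
  have := eqS 0%N; rewrite big_geq // addr0 => e0.
  rewrite -(pmulr_lle0 _ a0); have := mulr_gt0 o0 (a_gt0 1%N); lra.
have eqn : omega 0%N * a n.+1
    + \sum_(1 <= j < n.+2) omega j * a (n.+1 - j)%N = 0.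
  by have := eqS n; rewrite [in X in _ -> X]big_nat_recr //= subnn addrA.
rewrite -(pmulr_lle0 _ a0) -(pmulr_lle0 _ (a_gt0 n.+1)).
have -> : omega n.+2 * a 0%N * a n.+1
    = \sum_(1 <= j < n.+2) omega j *
        (a (n.+1 - j)%N * a n.+2 - a (n.+2 - j)%N * a n.+1).
  under eq_bigr do rewrite mulrBr !mulrA.
  rewrite sumrB -!mulr_suml.
  set S1 := \sum_(_ <= _ < _) _ in eqn *.
  move: (eqS n.+1); set S2 := \sum_(_ <= _ < _) _ => e2.
  have -> : omega n.+2 * a 0%N = - (omega 0%N * a n.+2) - S2 by lra.
  have -> : S1 = - (omega 0%N * a n.+1) by lra.
  ring.
rewrite big_nat_cond sumr_le0 // => j; rewrite andbT => /andP[le1j ltjn].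
apply: mulr_le0_ge0.
  by case: j le1j ltjn => // j _ ltjn; apply: IHn.
by rewrite subr_ge0 subSn // log_convex_ratio // leq_subr.
Qed.

End Kaluza.

(** * Monotonicity of the numerical solution *)

Section Monotonicity.
Variable R : realType.
Implicit Types (omega u v : nat -> R) (f : R -> R).

(** A discrete maximum principle for the relation [omega * v = e * v] with
pointwise factors [e n < omega 0]. *)
Lemma conv_sign_propagation omega v (e : nat -> R) :
  (forall n, omega n.+1 <= 0) -> (forall n, e n < omega 0%N) ->
  (forall n, convolution omega v n.+1 = e n.+1 * v n.+1) ->
  0 <= v 0%N -> forall n, 0 <= v n.
Proof.
move=> omega_le0 e_lt rec v0; elim/ltn_ind => -[//|n] IHn.
have e_gt0 : 0 < omega 0%N - e n.+1 by rewrite subr_gt0.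
rewrite -(pmulr_rge0 _ e_gt0).
have -> : (omega 0%N - e n.+1) * v n.+1
    = - \sum_(1 <= j < n.+2) omega j * v (n.+1 - j)%N.
  by have := rec n; rewrite convolution_recl; lra.
rewrite oppr_ge0 big_nat_cond sumr_le0 // => j; rewrite andbT => /andP[].
case: j => // j _ ltjn; rewrite mulr_le0_ge0 // subSS.
by apply: IHn; rewrite ltnS leq_subr.
Qed.

(** The equivalent form of the scheme in which the history acts on the increments
of [u]. It starts at the index 1 because at the index 0 the right-hand side
would be [h `^ alpha * f (u 1)], not a difference. *)
Lemma numerical_solution_increments (alpha h : R) omega a f (u0 : R) u n :
  is_conv_inverse omega a -> numerical_solution alpha h a f u0 u ->
  convolution omega (fun k => u k.+1 - u k) n.+1
  = h `^ alpha * (f (u n.+2) - f (u n.+1)).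
Proof.
move=> oinv [u00 un].
pose w k := u k - u0.
pose g k := if k is 0%N then 0 else h `^ alpha * f (u k).
have wE : w = convolution a g.
  apply/funext => -[|k]; first by rewrite /w u00 subrr /convolution big_nat1 mulr0.
  rewrite /w un // addrC addKr /convolution [in RHS]big_nat_recr //= subnn mulr0.
  rewrite addr0 mulr_sumr; apply: eq_big_nat => j /andP[_ ltjk].
  by rewrite subSn //= mulrCA.
have ow : convolution omega w = g.
  rewrite wE convolutionA.
  have -> : convolution omega a = delta_d R by apply/funext => k; exact: oinv.
  exact: convolution_delta_l.
have -> : (fun k => u k.+1 - u k) = (fun k => w k.+1 - w k).
  by apply/funext => k; rewrite /w; lra.
rewrite -convolution_shift_sub; last by rewrite /w u00 subrr.
by rewrite ow /= mulrBr.
Qed.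

(** The bound [L] on the slopes of chords is one-sided: only a too fast increase
of [f] can spoil the implicit step. *)
Lemma monotone_of_chord_slopes (alpha h L : R) omega a f (u0 : R) u :
  is_conv_inverse omega a -> completely_monotone a ->
  numerical_solution alpha h a f u0 u ->
  0 <= L -> h `^ alpha * L * a 0%N < 1 ->
  (forall x y, x != y -> (f x - f y) / (x - y) <= L) ->
  monotone_seq u.
Proof.
move=> oinv cma sol L0 small slope.
have a_ge0 n := completely_monotone_ge0 n cma.
have a_lc n := completely_monotone_log_convex n cma.
have o_le0 := conv_inverse_le0 a_ge0 a_lc oinv.
have o_gt0 := conv_inverse0_gt0 a_ge0 oinv.
have oa := conv_inverse0 oinv.
have a0 : 0 < a 0%N by rewrite -(pmulr_rgt0 _ o_gt0) oa.
have small' : h `^ alpha * L < omega 0%N by rewrite -(ltr_pM2r a0) oa.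
pose v k := u k.+1 - u k.
(* Division by zero returns 0, which is the right value when [v k = 0]. *)
pose e k := h `^ alpha * ((f (u k.+1) - f (u k)) / v k).
have e_lt k : e k < omega 0%N.
  apply: le_lt_trans small'; rewrite ler_wpM2l ?powR_ge0 //.
  have [eq_u|neq_u] := eqVneq (u k.+1) (u k); last exact: slope.
  by rewrite eq_u subrr mul0r.
have rec k : convolution omega v k.+1 = e k.+1 * v k.+1.
  rewrite (numerical_solution_increments _ oinv sol) /e /v -mulrA.
  have [->|neq_u] := eqVneq (u k.+2) (u k.+1); first by rewrite !subrr !mulr0.
  by rewrite divfK // subr_eq0.
have [v0|v0] := leP 0 (v 0%N).
  left; apply/nondecreasing_seqP => n; rewrite -subr_ge0.
  exact: (conv_sign_propagation o_le0 e_lt rec v0).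
right; apply/nonincreasing_seqP => n; rewrite -subr_ge0 -opprB.
have recN k : convolution omega (fun i => - v i) k.+1 = e k.+1 * - v k.+1.
  rewrite mulrN -rec /convolution -sumrN.
  by apply: eq_bigr => j _; rewrite mulrN.
by apply: (conv_sign_propagation o_le0 e_lt recN); rewrite oppr_ge0 ltW.
Qed.

Lemma chord_slope_le_sup_derive f (x y : R) :
  (forall z : R, derivable f z 1) ->
  has_ubound (range (fun z : R => `|f^`()%classic z|)) -> x != y ->
  (f x - f y) / (x - y) <= sup (range (fun z : R => `|f^`()%classic z|)).
Proof.
move=> df ub; wlog ltxy : x y / x < y => [wl neqxy|_].
  have [ltxy|ltyx|eqxy] := ltgtP x y; first exact: wl.
    by rewrite -opprB -[x - y]opprB invrN mulrNN wl // lt_eqF.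
  by move: neqxy; rewrite eqxy eqxx.
have [c _ fxy] : exists2 c, c \in `]x, y[%R & f y - f x = f^`()%classic c * (y - x).
  apply: MVT => // [z _|]; first by rewrite derive1E; exact/derivableP.
  apply: continuous_subspaceT => z; exact/differentiable_continuous/derivable1_diffP.
rewrite -opprB -[x - y]opprB invrN mulrNN fxy mulfK ?subr_eq0 ?gt_eqF //.
by apply: le_trans (ler_norm _) _; apply: ub_le_sup => //; exists c.
Qed.

End Monotonicity.

Theorem theorem4p1 (R : realType) (alpha : R) (f : R -> R) (u0 : R)
    (omega a : nat -> R) (h : R) (u : nat -> R)
    (halpha : 0 < alpha < 1)
    (hscheme : CM_preserving alpha omega a)
    (hh : 0 < h)
    (hu : numerical_solution alpha h a f u0 u) :
  (C1 f -> (forall x y : R, x <= y -> f y <= f x) -> monotone_seq u)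
  /\
  (C1 f -> has_ubound (range (fun x : R => `|f^`()%classic x|)) ->
    h `^ alpha * sup (range (fun x : R => `|f^`()%classic x|)) * a 0%N < 1 ->
    monotone_seq u).
Proof.
have [_ oinv _ cma] := hscheme; split=> [_ noninc|[df _] ub small].
  apply: (monotone_of_chord_slopes oinv cma hu (lexx 0)).
    by rewrite mulr0 mul0r.
  move=> x y _; have [lexy|/ltW leyx] := leP x y.
    by rewrite mulr_ge0_le0 ?invr_le0 ?subr_ge0 ?subr_le0 // noninc.
  by rewrite mulr_le0_ge0 ?invr_ge0 ?subr_ge0 ?subr_le0 // noninc.
apply: (monotone_of_chord_slopes oinv cma hu _ small).
  apply: (le_trans (normr_ge0 (f^`()%classic 0))).
  by apply: ub_le_sup => //; exists 0.
by move=> x y; exact: chord_slope_le_sup_derive.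
Qed.
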